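(* The class of languages recognizable by a QFA is not closed under any binary Boolean operation in which both arguments are significant. That is, for every function $f:\{0,1\}^2\to\{0,1\}$ that depends on both of its arguments, there are a finite alphabet $\Sigma$ and languages $L,L'\subseteq\Sigma^*$, each recognizable by a QFA, such that the language $f(L,L')=\{w\in\Sigma^*: f(\mathbf 1_{L}(w),\mathbf 1_{L'}(w))=1\}$ is not recognizable by a QFA.
   Context: $\mathbf 1_L(w)$ is $1$ if $w\in L$ and $0$ otherwise. A function $f:\{0,1\}^2\to\{0,1\}$ depends on both arguments if there are $s,u,v$ with $f(s,u)\ne f(s,v)$ and there are $s,u,v$ with $f(u,s)\neq f(v,s)$. A 1-way quantum finite automaton (QFA) is a tuple $(Q,\Sigma,V,q_0,Q_{acc},Q_{rej})$: $Q$ is a finite set of states, $\Sigma$ a finite input alphabet, $q_0\in Q$ the starting state, $Q_{acc},Q_{rej}\subseteq Q$ are disjoint sets of accepting and rejecting states, and $Q_{non}=Q\setminus(Q_{acc}\cup Q_{rej})$. Let $l_2(Q)$ be the complex Hilbert space with orthonormal basis $\{|q\rangle: q\in Q\}$, and $E_{acc},E_{rej},E_{non}$ the spans of $\{|q\rangle\}$ for $q$ in $Q_{acc},Q_{rej},Q_{non}$ respectively. With endmarkers $\kappa,\$\notin\Sigma$ and $\Gamma=\Sigma\cup\{\kappa,\$\}$, $V$ assigns to each $a\in\Gamma$ a unitary map $V_a$ on $l_2(Q)$. On input $w\in\Sigma^*$ the automaton starts in $|q_0\rangle$ and reads the letters of $\kappa w\$$ in order. Reading $a$ in the current (unnormalized)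 superposition $\psi$ means: compute $V_a\psi$; the automaton accepts (and halts) with probability the squared norm of the projection of $V_a\psi$ onto $E_{acc}$, rejects (and halts) with probability the squared norm of its projection onto $E_{rej}$, and otherwise continues with the unnormalized superposition equal to the projection of $V_a\psi$ onto $E_{non}$. The probability of accepting (rejecting) $w$ is the sum of these acceptance (rejection) probabilities over all letters of $\kappa w\$$. A QFA recognizes $L$ with probability $p>\frac12$ if it accepts every $w\in L$ with probability $\geq p$ and rejects every $w\in\Sigma^*\setminus L$ with probability $\geq p$. $L$ is recognizable by a QFA if this holds for some QFA and some $p>\frac12$. *)

(* Defs.v *)
From HB Require Import structures.
From mathcomp Require Import all_boot all_order all_algebra.
From mathcomp Require Import reals complex.

Set Implicit Arguments.
Unset Strict Implicit.
Unset Printing Implicit Defensive.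

Import Order.TTheory GRing.Theory Num.Theory.
Local Open Scope ring_scope.
Local Open Scope complex_scope.

Definition depends_on_both (f : bool -> bool -> bool) : Prop :=
  (exists s u v, f s u <> f s v) /\ (exists s u v, f u s <> f v s).

Inductive endmarked (S : Type) : Type :=
  | LeftEnd : endmarked S
  | RightEnd : endmarked S
  | Letter : S -> endmarked S.

Arguments LeftEnd {S}.
Arguments RightEnd {S}.
Arguments Letter {S} a.

Definition endmark (S : Type) (w : seq S) : seq (endmarked S) :=
  LeftEnd :: rcons (map Letter w) RightEnd.

(* The states are numbered, so that a superposition is a column vector of
   amplitudes and each unitary map on l_2(Q) is given by its matrix in the
   basis of states, acting on the left. *)
Record qfa (R : realType) (S : finType) : Type := QFA {
  qfa_n : nat;
  qfa_V : endmarked S -> 'M[R[i]]_qfa_n;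
  qfa_q0 : 'I_qfa_n;
  qfa_acc : {set 'I_qfa_n};
  qfa_rej : {set 'I_qfa_n};
  qfa_unitary : forall a, qfa_V a \is unitarymx;
  qfa_disjoint : [disjoint qfa_acc & qfa_rej]
}.

Section Probabilities.
Variable R : realType.

Definition basis_state (n : nat) (q : 'I_n) : 'cV[R[i]]_n := delta_mx q 0.

Definition proj_states (n : nat) (A : {set 'I_n}) (psi : 'cV[R[i]]_n) :
    'cV[R[i]]_n :=
  \col_q (if q \in A then psi q 0 else 0).

(* ComplexField.Normc.normc is the modulus as an element of R; the generic
   norm of R[i] takes its values in R[i]. *)
Definition sqnorm (n : nat) (psi : 'cV[R[i]]_n) : R :=
  \sum_q ComplexField.Normc.normc (psi q 0) ^+ 2.

Variables (S : finType) (M : qfa R S).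

Definition qfa_non : {set 'I_(qfa_n M)} := ~: (qfa_acc M :|: qfa_rej M).

(* Total probability of halting in A while reading w from the unnormalized
   superposition psi; meant for A = qfa_acc M and A = qfa_rej M. *)
Fixpoint halt_prob (A : {set 'I_(qfa_n M)}) (psi : 'cV[R[i]]_(qfa_n M))
    (w : seq (endmarked S)) : R :=
  if w is a :: w' then
    let phi := qfa_V M a *m psi in
    sqnorm (proj_states A phi) + halt_prob A (proj_states qfa_non phi) w'
  else 0.

Definition accept_prob (w : seq S) : R :=
  halt_prob (qfa_acc M) (basis_state (qfa_q0 M)) (endmark w).

Definition reject_prob (w : seq S) : R :=
  halt_prob (qfa_rej M) (basis_state (qfa_q0 M)) (endmark w).

Definition recognizes_with (L : pred (seq S)) (p : R) : Prop :=
  forall w : seq S,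
    (L w -> p <= accept_prob w) /\ (~~ L w -> p <= reject_prob w).

End Probabilities.

Definition qfa_recognizable (R : realType) (S : finType) (L : pred (seq S)) :
    Prop :=
  exists (M : qfa R S) (p : R), 2^-1 < p /\ recognizes_with M L p.

Definition lang_op (f : bool -> bool -> bool) (S : Type) (L L' : pred (seq S)) :
    pred (seq S) :=
  fun w => f (L w) (L' w).

(* Main.v *)
(** The pieces are "the word starts with [Some true] and has an even number of
    [None]" and "the word starts with [Some false] and has an odd number of
    [None]". They are disjoint, and after complementing the arguments and the
    value, every [f] depending on both arguments acts on them as a union.

    Each piece is recognized by tracking the parity with amplitude 3/5 only: the
    remaining amplitude 4/5 rejects at once on a wrong first letter, and on a
    right one is spread over accepting and rejecting, leaving the decision to
    the parity.

    The union is not recognizable. Let [x], [y] be the two starting letters and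
    [T] a product of their non-halting maps, of nearly minimal Frobenius norm.
    All products [T A] with [A] a word in [x], [y] have nearly the same norm,
    which forces [T A A*] to be close to [T]; together with two close terms in
    the bounded sequence [T V_x^k], this gives [T V_x^r] close to [T] for some
    [r > 0], and likewise [T V_y^s]. So a word starting with [x] and one starting
    with [y] lead to almost the same superposition. Appending the tails that
    exchange the two classes, the four halting probabilities that should exceed
    1/2 sum to almost at most 2. *)

Require Import Defs.
From mathcomp Require Import all_boot all_order all_algebra.
From mathcomp Require Import reals complex.
From mathcomp Require Import ring lra zify.

Set Implicit Arguments.
Unset Strict Implicit.
Unset Printing Implicit Defensive.

Import Order.TTheory GRing.Theory Num.Theory.
Local Open Scope ring_scope.
Local Open Scope complex_scope.
Local Open Scope sesquilinear_scope.

(** * Frobenius norm and contractions *)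

Section Frobenius.
Variable R : realType.
Implicit Types m n p : nat.

(** The real part of the Hermitian inner product, in real coordinates so that all estimates take
    place in the ordered field [R]. *)
Definition frob_dot m n (A B : 'M[R[i]]_(m, n)) : R :=
  \sum_i \sum_j (complex.Re (A i j) * complex.Re (B i j)
                 + complex.Im (A i j) * complex.Im (B i j)).

Definition frob_sq m n (A : 'M[R[i]]_(m, n)) : R := frob_dot A A.

Lemma sqr_normc_ReIm (z : R[i]) :
  ComplexField.Normc.normc z ^+ 2 = complex.Re z ^+ 2 + complex.Im z ^+ 2.
Proof.
by case: z => a b /=; rewrite sqr_sqrtr // addr_ge0 // sqr_ge0.
Qed.

Lemma sqnorm_frob n (psi : 'cV[R[i]]_n) : sqnorm psi = frob_sq psi.
Proof.
apply: eq_bigr => q _; rewrite big_ord1 sqr_normc_ReIm.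
by rewrite !expr2.
Qed.

Lemma Re_sum (I : Type) (s : seq I) (F : I -> R[i]) :
  complex.Re (\sum_(i <- s) F i) = \sum_(i <- s) complex.Re (F i).
Proof.
elim: s => [|i s IH]; rewrite ?big_nil // !big_cons -IH.
by case: (F i) => a b; case: (\sum_(_ <- _) _).
Qed.

Lemma frob_dot_trace m n (A B : 'M[R[i]]_(m, n)) :
  frob_dot A B = complex.Re (\tr (A *m B ^t*)).
Proof.
rewrite /mxtrace Re_sum; apply: eq_bigr => i _.
rewrite mxE Re_sum; apply: eq_bigr => j _; rewrite !mxE.
by case: (A i j) => a b; case: (B i j) => c d /=; ring.
Qed.

Lemma trmxC_mul m n p (A : 'M[R[i]]_(m, n)) (B : 'M_(n, p)) :
  (A *m B) ^t* = B ^t* *m A ^t*.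
Proof. by rewrite trmx_mul map_mxM. Qed.

Lemma frob_dot_adj m n p (A : 'M[R[i]]_(m, n)) (M : 'M_(n, p)) B :
  frob_dot (A *m M) B = frob_dot A (B *m M ^t*).
Proof. by rewrite !frob_dot_trace trmxC_mul trmxCK mulmxA. Qed.

Lemma frob_sq_ge0 m n (A : 'M[R[i]]_(m, n)) : 0 <= frob_sq A.
Proof. by do 2![apply: sumr_ge0 => ? _]; rewrite addr_ge0 // -expr2 sqr_ge0. Qed.

Lemma frob_sqB m n (A B : 'M[R[i]]_(m, n)) :
  frob_sq (A - B) = frob_sq A + frob_sq B - 2 * frob_dot A B.
Proof.
rewrite /frob_sq /frob_dot mulr_sumr -sumrN -!big_split; apply: eq_bigr => i _.
rewrite mulr_sumr -sumrN -!big_split; apply: eq_bigr => j _; rewrite !mxE.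
by case: (A i j) => a b; case: (B i j) => c d /=; ring.
Qed.

Lemma frob_sqN m n (A : 'M[R[i]]_(m, n)) : frob_sq (- A) = frob_sq A.
Proof.
do 2![apply: eq_bigr => ? _]; rewrite !mxE.
by case: (A _ _) => a b /=; ring.
Qed.

Lemma frob_sq_tr m n (A : 'M[R[i]]_(m, n)) : frob_sq (A ^t*) = frob_sq A.
Proof.
rewrite /frob_sq /frob_dot exchange_big; do 2![apply: eq_bigr => ? _].
by rewrite !mxE; case: (A _ _) => a b /=; ring.
Qed.

(** Young's inequality entrywise: the gap is the square [c * (x - c^-1 * y) ^+ 2]. A small [c] keeps
    the first coefficient near 1. *)
Lemma frob_sqD m n (A B : 'M[R[i]]_(m, n)) (c : R) : 0 < c ->
  frob_sq (A + B) <= (1 + c) * frob_sq A + (1 + c^-1) * frob_sq B.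
Proof.
move=> c0; rewrite /frob_sq /frob_dot !mulr_sumr -big_split ler_sum // => i _.
rewrite !mulr_sumr -big_split ler_sum // => j _; rewrite !mxE /=.
have sqD (x y : R) :
    (x + y) ^+ 2 <= (1 + c) * x ^+ 2 + (1 + c^-1) * y ^+ 2.
  rewrite -subr_ge0.
  have -> : (1 + c) * x ^+ 2 + (1 + c^-1) * y ^+ 2 - (x + y) ^+ 2
            = c * (x - c^-1 * y) ^+ 2 by field; rewrite gt_eqF.
  by rewrite mulr_ge0 ?sqr_ge0 // ltW.
case: (A i j) => a b; case: (B i j) => a' b' /=.
by have := sqD a a'; have := sqD b b'; lra.
Qed.

Lemma frob_sqD2 m n (A B : 'M[R[i]]_(m, n)) :
  frob_sq (A + B) <= 2 * frob_sq A + 2 * frob_sq B.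
Proof. by have := frob_sqD A B (@ltr01 R); rewrite invr1. Qed.

(** Operator norm at most 1, as an action on the right; including the adjoint gives the bounds for
    [A ^t*] and for left multiplication at once. *)
Definition contraction n (A : 'M[R[i]]_n) : Prop :=
  forall m (T : 'M[R[i]]_(m, n)),
    frob_sq (T *m A) <= frob_sq T /\ frob_sq (T *m A ^t*) <= frob_sq T.

Lemma contraction1 n : contraction (1%:M : 'M[R[i]]_n).
Proof. by move=> m T; rewrite trmx1 map_mx1 mulmx1. Qed.

Lemma contractionM n (A B : 'M[R[i]]_n) :
  contraction A -> contraction B -> contraction (A *m B).
Proof.
move=> cA cB m T; rewrite trmxC_mul !mulmxA; split.
  exact: le_trans (cB _ _).1 (cA _ _).1.
exact: le_trans (cA _ _).2 (cB _ _).2.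
Qed.

Lemma unitary_frob_sq m n (U : 'M[R[i]]_n) (T : 'M_(m, n)) :
  U \is unitarymx -> frob_sq (T *m U) = frob_sq T.
Proof.
by move=> /unitarymxP UU; rewrite /frob_sq frob_dot_adj -mulmxA UU mulmx1.
Qed.

Lemma unitary_contraction n (U : 'M[R[i]]_n) :
  U \is unitarymx -> contraction U.
Proof.
by move=> Uu m T; rewrite !unitary_frob_sq // trmxC_unitary.
Qed.

Lemma contraction_mull n (A : 'M[R[i]]_n) p (psi : 'M_(n, p)) :
  contraction A -> frob_sq (A *m psi) <= frob_sq psi.
Proof.
by move=> cA; rewrite -frob_sq_tr trmxC_mul -[leRHS]frob_sq_tr; case: (cA _ (psi ^t*)).
Qed.

(* [|T A A* - T|^2 <= |T|^2 - |T A|^2], since [<T A A*, T> = |T A|^2]. *)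
Lemma contraction_almost_isometry m n (A : 'M[R[i]]_n) (T : 'M_(m, n)) (e : R) :
  contraction A -> frob_sq T - e <= frob_sq (T *m A) ->
  frob_sq (T *m A *m A ^t* - T) <= e.
Proof.
move=> cA; rewrite frob_sqB frob_dot_adj trmxCK -/(frob_sq (T *m A)).
by have := (cA _ (T *m A)).2; lra.
Qed.

Definition proj_mx n (S : {set 'I_n}) : 'M[R[i]]_n :=
  diag_mx (\row_q (q \in S)%:R).

Lemma proj_states_mul n (S : {set 'I_n}) (psi : 'cV[R[i]]_n) :
  proj_states S psi = proj_mx S *m psi.
Proof.
apply/colP => q; rewrite mul_diag_mx !mxE.
by case: (q \in S); rewrite ?mul1r ?mul0r.
Qed.

Lemma proj_mx_contraction n (S : {set 'I_n}) : contraction (proj_mx S).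
Proof.
have trP : (proj_mx S) ^t* = proj_mx S.
  apply/matrixP => i j; rewrite !mxE eq_sym; case: eqVneq => [->|_].
    by rewrite rmorphMn rmorph_nat.
  by rewrite !mulr0n rmorph0.
move=> m T; rewrite trP; suff: frob_sq (T *m proj_mx S) <= frob_sq T by [].
apply: ler_sum => i _; apply: ler_sum => j _.
rewrite mul_mx_diag !mxE; case: (T i j) => a b /=.
by case: (j \in S) => /=; nra.
Qed.

(** * Close terms in bounded sequences *)

Lemma bounded_seq_close (I : finType) (u : nat -> I -> R) (K d : R) :
  (forall k i, `|u k i| <= K) -> 0 < d ->
  exists j k, (j < k)%N /\ forall i, `|u j i - u k i| <= d.
Proof.
move=> uK d0; pose cell x : nat := Num.truncn ((x + K) / d).
pose N := Num.truncn ((K + K) / d).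
have cell_ge0 k i : 0 <= (u k i + K) / d.
  by rewrite divr_ge0 ?(ltW d0) //; have := uK k i; rewrite ler_norml; lra.
have cellN k i : (cell (u k i) < N.+1)%N.
  rewrite ltnS; apply: le_truncn; rewrite ler_pM2r ?invr_gt0 // lerD2r.
  exact: le_trans (ler_norm _) (uK k i).
(* Pigeonhole: each index is coded by the grid cell of side [d] that contains its point, and there
   are only finitely many cells. *)
pose code k := [ffun i => inord (cell (u k i)) : 'I_N.+1].
pose T := {ffun I -> 'I_N.+1}.
have /injectivePn[j [k jk ejk]] : ~~ injectiveb (fun k : 'I_#|T|.+1 => code k).
  by apply/injectiveP => /leq_card; rewrite card_ord ltnn.
have close i : `|u j i - u k i| <= d.
  have ecell : cell (u j i) = cell (u k i).
    have /(congr1 (@nat_of_ord _)) := congr1 (fun c : T => c i) ejk.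
    by rewrite !ffunE !inordK.
  have := truncn_itv (cell_ge0 j i); have := truncn_itv (cell_ge0 k i).
  rewrite -/(cell (u j i)) -/(cell (u k i)) ecell -natr1.
  set t := _%:R; rewrite !ler_pdivlMr // !ltr_pdivrMr // ler_norml.
  by move=> /andP[? ?] /andP[? ?]; apply/andP; split; lra.
have [lt_jk|lt_kj|/val_inj /eqP] := ltngtP j k.
- by exists j, k.
- by exists k, j; split=> // i; rewrite distrC.
- by rewrite (negPf jk).
Qed.

Lemma bounded_mx_seq_close m n (M : nat -> 'M[R[i]]_(m, n)) (K e : R) :
  (forall k, frob_sq (M k) <= K) -> 0 < e ->
  exists j k, (j < k)%N /\ frob_sq (M j - M k) <= e.
Proof.
move=> MK e0; pose part b (z : R[i]) := if b then complex.Re z else complex.Im z.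
pose u k (t : 'I_m * 'I_n * bool) := part t.2 (M k t.1.1 t.1.2).
(* [c] exceeds the number of real coordinates, so squared gaps of at most [e / c] add up to at most
   [e]. *)
pose c : R := (m * n * 2)%:R + 1; have c0 : 0 < c by rewrite ltr_wpDl.
have uK k t : `|u k t| <= K + 1.
  have : u k t ^+ 2 <= K.
    apply: le_trans (MK k); rewrite /u; case: t => -[i j] b /=.
    rewrite /frob_sq /frob_dot (bigD1 i) //= (bigD1 j) //=.
    set x := \sum_(_ | _) _; set y := \sum_(_ | _) _.
    have x0 : 0 <= x by apply: sumr_ge0 => ? _; rewrite addr_ge0 // -expr2 sqr_ge0.
    have y0 : 0 <= y.
      by do 2![apply: sumr_ge0 => ? _]; rewrite addr_ge0 // -expr2 sqr_ge0.
    by case: (M k i j) => a a'; case: b => /=; nra.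
  rewrite ler_norml; set x := u k t => xK; apply/andP; split; nra.
(* [d <= 1] gives [d ^+ 2 <= d <= e / c] without a square root. *)
pose d := Num.min 1 (e / c).
have d0 : 0 < d by rewrite lt_min ltr01 divr_gt0.
have [j [k [jk close]]] := bounded_seq_close uK d0.
exists j, k; split=> //.
have sq_le i l b : (u j (i, l, b) - u k (i, l, b)) ^+ 2 <= e / c.
  have d1 : d <= 1 by rewrite ge_min lexx.
  have dc : d <= e / c by rewrite ge_min lexx orbT.
  by have := close (i, l, b); rewrite ler_norml => /andP[]; nra.
have : frob_sq (M j - M k) <= \sum_(i < m) \sum_(l < n) (e / c) *+ 2.
  apply: ler_sum => i _; apply: ler_sum => l _; rewrite !mxE.
  have := sq_le i l true; have := sq_le i l false; rewrite /u /part /=.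
  by case: (M j i l) => a b; case: (M k i l) => a' b' /=; rewrite mulr2n; lra.
move/le_trans; apply; rewrite !sumr_const !card_ord -!mulrnA.
rewrite -mulr_natr mulrAC ler_pdivrMr // ler_pM2l //.
by rewrite /c natr1 ler_nat; lia.
Qed.

(** * Products of contractions along words *)

Section WordProducts.
Variables (n : nat) (X : Type) (F : X -> 'M[R[i]]_n).

(* The first letter acts first, i.e. is the rightmost factor. *)
Fixpoint word_mx (w : seq X) : 'M[R[i]]_n :=
  if w is a :: w' then word_mx w' *m F a else 1%:M.

Lemma word_mx_cat u v : word_mx (u ++ v) = word_mx v *m word_mx u.
Proof. by elim: u => [|a u IH] /=; rewrite ?mulmx1 // IH mulmxA. Qed.

Hypothesis contrF : forall a, contraction (F a).

Lemma word_mx_contraction w : contraction (word_mx w).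
Proof.
elim: w => [|a w IH] /=; [exact: contraction1 | exact: contractionM].
Qed.

(** [t] comes within [e] of the infimum over all words, which need not be attained. *)
Lemma exists_almost_minimal_word (e : R) : 0 < e ->
  exists t, forall u, frob_sq (word_mx t) - e <= frob_sq (word_mx u).
Proof.
move=> e0; pose E (x : R) := exists t, x = frob_sq (word_mx t).
have lbE : classical_sets.has_lbound E by exists 0 => _ [t ->]; exact: frob_sq_ge0.
have infE : classical_sets.has_inf E by split=> //; exists (frob_sq (word_mx [::])), [::].
have [_ [t ->] tE] := inf_adherent e0 infE; exists t => u.
rewrite lerBlDr (le_trans (ltW tE)) // lerD2r; apply: ge_inf => //.
by exists u.
Qed.

Lemma word_mx_recurrence (e : R) t : 0 < e ->
  (forall u, frob_sq (word_mx t) - e <= frob_sq (word_mx u)) ->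
  forall x, exists r,
    frob_sq (word_mx (nseq r.+1 x ++ t) - word_mx t) <= 10 * e.
Proof.
move=> e0 tmin x.
have bounded k : frob_sq (word_mx (nseq k x ++ t)) <= frob_sq (word_mx t).
  by rewrite word_mx_cat; case: (word_mx_contraction (nseq k x) (word_mx t)).
have [j [k [jk close]]] := bounded_mx_seq_close bounded e0.
exists (k - j.+1)%N; set r := (k - j.+1)%N.
have ek : k = (j + r.+1)%N by rewrite /r; lia.
set T := word_mx t; set A := word_mx (nseq j x).
have cA : contraction A by exact: word_mx_contraction.
set T' := word_mx (nseq r.+1 x ++ t).
have eT : word_mx (nseq j x ++ t) = T *m A by rewrite word_mx_cat.
have eT' : word_mx (nseq k x ++ t) = T' *m A.
  by rewrite ek nseqD -catA word_mx_cat.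
have aT : frob_sq (T *m A *m A ^t* - T) <= e.
  by apply: contraction_almost_isometry => //; rewrite -eT.
(* [T'] is no larger than [T], and [T' *m A] is itself a word product, so near-minimality of [T]
   also makes [A] almost isometric on [T']. *)
have aT' : frob_sq (T' *m A *m A ^t* - T') <= e.
  apply: contraction_almost_isometry => //; rewrite -eT'.
  by have := tmin (nseq k x ++ t); have := bounded r.+1; rewrite -/T'; lra.
have dA : frob_sq ((T *m A - T' *m A) *m A ^t*) <= e.
  by apply: le_trans (cA _ _).2 _; rewrite -eT -eT'.
(* Three terms of squared norm at most [e]; two uses of [frob_sqD2] give
   [2 * e + 2 * (2 * e + 2 * e)]. *)
have -> : T' - T = - (T' *m A *m A ^t* - T')
    + ((T *m A *m A ^t* - T) + - ((T *m A - T' *m A) *m A ^t*)).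
  rewrite mulmxBl !opprB; move: (T' *m A *m _) (T *m A *m _) => X1 X2.
  by rewrite [X2 - T + _]addrC (addrA (X1 - X2)) subrK (addrA (T' - X1)) subrK.
have := frob_sqD2 (- (T' *m A *m A ^t* - T'))
  ((T *m A *m A ^t* - T) + - ((T *m A - T' *m A) *m A ^t*)).
have := frob_sqD2 (T *m A *m A ^t* - T) (- ((T *m A - T' *m A) *m A ^t*)).
by rewrite !frob_sqN; lra.
Qed.

Lemma word_mx_merge (x y : X) (e : R) : 0 < e ->
  exists t r s,
    frob_sq (word_mx (nseq r.+1 x ++ t) - word_mx (nseq s.+1 y ++ t)) <= e.
Proof.
(* Each return to [t] costs [10 * (e / 40)]; the two costs are doubled and added. *)
move=> e0; have e40 : 0 < e / 40 by rewrite divr_gt0.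
have [t tmin] := exists_almost_minimal_word e40.
have [r xr] := word_mx_recurrence e40 tmin x.
have [s ys] := word_mx_recurrence e40 tmin y.
exists t, r, s; rewrite -[_ - word_mx (_ ++ _)](subrKA (word_mx t)).
have := frob_sqD2 (word_mx (nseq r.+1 x ++ t) - word_mx t)
  (- (word_mx (nseq s.+1 y ++ t) - word_mx t)).
by rewrite frob_sqN opprB => /le_trans; apply; lra.
Qed.

End WordProducts.


Lemma word_mx_map n (X Y : Type) (g : X -> Y) (F : Y -> 'M[R[i]]_n) w :
  word_mx F (map g w) = word_mx (F \o g) w.
Proof. by elim: w => //= a w ->. Qed.

Lemma frob_sq_mul_basis m n (A : 'M[R[i]]_(m, n)) q :
  frob_sq (A *m basis_state R q) <= frob_sq A.
Proof.
rewrite /basis_state -colE; apply: ler_sum => i _; rewrite big_ord1 !mxE.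
rewrite (bigD1 q) //= lerDl.
by apply: sumr_ge0 => ? _; rewrite addr_ge0 // -expr2 sqr_ge0.
Qed.

Lemma frob_sq_basis n (q : 'I_n) : frob_sq (basis_state R q) = 1.
Proof.
rewrite /frob_sq /frob_dot (bigD1 q) //= !big_ord1 !mxE !eqxx /=.
rewrite big1 => [|j /negPf jq]; first by ring.
by rewrite big_ord1 !mxE jq /=; ring.
Qed.

(** * Runs of an automaton as matrix products *)

Section Runs.
Variables (S : finType) (M : qfa R S).
Implicit Types (psi chi : 'cV[R[i]]_(qfa_n M)) (A : {set 'I_(qfa_n M)}).

Definition step_mx (a : endmarked S) : 'M[R[i]]_(qfa_n M) :=
  proj_mx (qfa_non M) *m qfa_V M a.

Lemma step_mx_contraction a : contraction (step_mx a).
Proof.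
apply: contractionM; first exact: proj_mx_contraction.
exact/unitary_contraction/qfa_unitary.
Qed.

Lemma halt_prob_cat A psi u v :
  halt_prob A psi (u ++ v)
  = halt_prob A psi u + halt_prob A (word_mx step_mx u *m psi) v.
Proof.
elim: u psi => [|a u IH] psi /=; first by rewrite mul1mx add0r.
by rewrite IH addrA !proj_states_mul !mulmxA.
Qed.

Lemma frob_sq_mull_unitary a psi : frob_sq (qfa_V M a *m psi) = frob_sq psi.
Proof.
rewrite -frob_sq_tr trmxC_mul unitary_frob_sq ?frob_sq_tr //.
by rewrite trmxC_unitary qfa_unitary.
Qed.

Lemma halt_prob_ge0 A psi w : 0 <= halt_prob A psi w.
Proof.
by elim: w psi => //= a w IH psi; rewrite addr_ge0 // sqnorm_frob frob_sq_ge0.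
Qed.

(** Each unitary map preserves the norm, and the accepting, rejecting and non-halting projections
    split it orthogonally. *)
Lemma halt_prob_total psi w :
  halt_prob (qfa_acc M) psi w + halt_prob (qfa_rej M) psi w <= frob_sq psi.
Proof.
elim: w psi => [|a w IH] psi /=; first by rewrite addr0 frob_sq_ge0.
rewrite -(frob_sq_mull_unitary a) !sqnorm_frob addrACA.
set phi := qfa_V M a *m psi; apply: le_trans (lerD (lexx _) (IH _)) _.
rewrite /frob_sq /frob_dot -!big_split; apply: ler_sum => q _.
rewrite !big_ord1 !mxE /qfa_non !inE.
have := disjointFr (qfa_disjoint M) (x := q).
case: (phi q 0) => b c; case: (q \in qfa_acc M) => [/(_ isT) ->|_] /=; first lra.
by case: (q \in qfa_rej M) => /=; lra.
Qed.

(** Halting probabilities are sums of squared norms of linear images of the superposition, so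
    [frob_sqD] passes to them. *)
Lemma halt_probD A psi chi w (c : R) : 0 < c ->
  halt_prob A (psi + chi) w
    <= (1 + c) * halt_prob A psi w + (1 + c^-1) * halt_prob A chi w.
Proof.
move=> c0; elim: w psi chi => [|a w IH] psi chi /=; first by rewrite !mulr0 addr0.
rewrite !proj_states_mul !sqnorm_frob !mulmxDr.
apply: le_trans (lerD (frob_sqD _ _ c0) (IH _ _)) _; lra.
Qed.

(** In [halt_probD] for [psi] and [chi - psi], the excess [c * halt_prob A psi w] and the term of
    the difference are each at most [c]. *)
Lemma halt_prob_perturb A psi chi w (c : R) :
    A = qfa_acc M \/ A = qfa_rej M -> 0 < c ->
    frob_sq psi <= 1 -> frob_sq (chi - psi) <= c / (1 + c^-1) ->
  halt_prob A chi w <= halt_prob A psi w + 2 * c.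
Proof.
move=> accrej c0 psi1 close.
have le_sq phi : halt_prob A phi w <= frob_sq phi.
  have := halt_prob_total phi w.
  have := halt_prob_ge0 (qfa_acc M) phi w; have := halt_prob_ge0 (qfa_rej M) phi w.
  by case: accrej => ->; lra.
have := halt_probD A psi (chi - psi) w c0; rewrite addrC subrK => /le_trans; apply.
have c10 : 0 < 1 + c^-1 by rewrite addr_gt0 ?invr_gt0.
have : (1 + c^-1) * halt_prob A (chi - psi) w <= c.
  by rewrite mulrC -ler_pdivlMr //; apply: le_trans (le_sq _) close.
have : c * halt_prob A psi w <= c.
  by rewrite ger_pMr //; apply: le_trans (le_sq _) psi1.
lra.
Qed.

End Runs.

Lemma merging_prefixes_not_recognizable (S : finType) (L : pred (seq S))
    (x y : S) (z1 z2 : seq S) :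
    (forall r (t : seq S), {subset t <= [:: x; y]} ->
      [/\ L (nseq r.+1 x ++ t ++ z1), ~~ L (nseq r.+1 x ++ t ++ z2),
          ~~ L (nseq r.+1 y ++ t ++ z1) & L (nseq r.+1 y ++ t ++ z2)]) ->
  ~ qfa_recognizable R L.
Proof.
move=> sepL [M [p [p_gt recM]]].
(* Words over [bool] stand for words in [x] and [y] only, so the word [t] obtained below satisfies
   the premise of [sepL]. *)
pose letter b := if b then x else y.
pose F b := step_mx M (Letter (letter b)).
have contrF b : contraction (F b) by exact: step_mx_contraction.
pose c := (p - 2^-1) / 2; have c0 : 0 < c by rewrite divr_gt0 // subr_gt0.
(* Small letters are probabilities collected on the prefixes [u] and [v], capitals those on the
   tails, with rejections primed for [z2]. Each prefix occurs with both tails, so its own share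
   cancels; adding up gives [4 * p <= 2 + 4 * c = 2 * p + 1]. *)
have balance (au ru av rv Au Ru Ru' Rv Rv' Av : R) :
    p <= au + Au -> p <= ru + Ru' -> p <= rv + Rv -> p <= av + Av ->
    au + Au + (ru + Ru) <= 1 -> av + Av + (rv + Rv') <= 1 ->
    Rv <= Ru + 2 * c -> Ru' <= Rv' + 2 * c -> False.
  by rewrite /c; lra.
have e0 : 0 < c / (1 + c^-1) by rewrite divr_gt0 // addr_gt0 ?invr_gt0.
have [t [r [s merge]]] := word_mx_merge contrF true false e0.
pose u := nseq r.+1 x ++ map letter t; pose v := nseq s.+1 y ++ map letter t.
pose psi w := word_mx (step_mx M) (LeftEnd :: map Letter w)
  *m basis_state R (qfa_q0 M).
have psiE w :
    psi (map letter w) = word_mx F w *m step_mx M LeftEnd *m basis_state R (qfa_q0 M).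
  by rewrite /psi /= -map_comp word_mx_map.
have uE : u = map letter (nseq r.+1 true ++ t) by rewrite map_cat map_nseq.
have vE : v = map letter (nseq s.+1 false ++ t) by rewrite map_cat map_nseq.
have psi1 w : frob_sq (psi w) <= 1.
  rewrite -(frob_sq_basis (qfa_q0 M)); apply: contraction_mull.
  exact/word_mx_contraction/step_mx_contraction.
(* The left endmarker and the starting vector are common right factors that do not increase the
   norm. *)
have close : frob_sq (psi u - psi v) <= c / (1 + c^-1).
  rewrite uE vE !psiE -!mulmxBl.
  apply: le_trans (frob_sq_mul_basis _ _) _.
  exact: le_trans (step_mx_contraction _ _).1 merge.
have close' : frob_sq (psi v - psi u) <= c / (1 + c^-1).
  by rewrite -frob_sqN opprB.
pose tail (z : seq S) := rcons (map Letter z) RightEnd.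
pose head (A : {set 'I_(qfa_n M)}) (w : seq S) :=
  halt_prob A (basis_state R (qfa_q0 M)) (LeftEnd :: map Letter w).
have halt_cat (A : {set 'I_(qfa_n M)}) w z :
    halt_prob A (basis_state R (qfa_q0 M)) (endmark (w ++ z))
    = head A w + halt_prob A (psi w) (tail z).
  by rewrite /endmark map_cat rcons_cat -cat_cons halt_prob_cat.
have total w z : accept_prob M (w ++ z) + reject_prob M (w ++ z) <= 1.
  by rewrite -(frob_sq_basis (qfa_q0 M)) halt_prob_total.
have tsub : {subset map letter t <= [:: x; y]}.
  by move=> _ /mapP[[] _ ->]; rewrite !inE eqxx ?orbT.
have [Lu1 Lu2 _ _] := sepL r _ tsub; have [_ _ Lv1 Lv2] := sepL s _ tsub.
rewrite !catA -/u -/v in Lu1 Lu2 Lv1 Lv2.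
have := total v z2; have := total u z1.
have := (recM _).1 Lv2; have := (recM _).2 Lv1.
have := (recM _).2 Lu2; have := (recM _).1 Lu1.
rewrite /accept_prob /reject_prob !halt_cat => Au1 Ru2 Rv1 Av2 tu tv.
apply: (balance _ _ _ _ _ _ _ _ _ _ Au1 Ru2 Rv1 Av2 tu tv).
  exact: halt_prob_perturb (or_intror erefl) c0 (psi1 u) close'.
exact: halt_prob_perturb (or_intror erefl) c0 (psi1 v) close.
Qed.

End Frobenius.

(** * Complements, by exchanging accepting and rejecting states *)

Section Complement.
Variables (R : realType) (S : finType).

Lemma eq_recognizable (L L' : pred (seq S)) :
  L =1 L' -> qfa_recognizable R L -> qfa_recognizable R L'.
Proof.
by move=> eqL [M [p [p_gt recM]]]; exists M, p; split=> // w; rewrite -eqL.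
Qed.

Lemma swap_disjoint (M : qfa R S) : [disjoint qfa_rej M & qfa_acc M].
Proof. by rewrite disjoint_sym qfa_disjoint. Qed.

Definition swap_qfa (M : qfa R S) : qfa R S :=
  QFA (qfa_q0 M) (@qfa_unitary R S M) (swap_disjoint M).

Lemma halt_prob_swap (M : qfa R S) (A : {set 'I_(qfa_n M)}) psi w :
  halt_prob (M := swap_qfa M) A psi w = halt_prob A psi w.
Proof.
elim: w psi => //= a w IH psi; rewrite IH.
by rewrite [qfa_non (swap_qfa M)](_ : _ = qfa_non M) // /qfa_non setUC.
Qed.

Lemma complement_recognizable (L : pred (seq S)) :
  qfa_recognizable R L -> qfa_recognizable R (fun w => ~~ L w).
Proof.
move=> [M [p [p_gt recM]]]; exists (swap_qfa M), p; split=> // w.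
rewrite /accept_prob /reject_prob !halt_prob_swap negbK.
by have [accM rejM] := recM w.
Qed.

Lemma addb_recognizable (b : bool) (L : pred (seq S)) :
  qfa_recognizable R L -> qfa_recognizable R (fun w => b (+) L w).
Proof. by case: b => //; exact: complement_recognizable. Qed.

End Complement.

(** Colour the corners of a square by [f]. Dependence on both arguments leaves either one corner
    unlike the other three, which works, or an alternating colouring, where every corner works. *)
Lemma exists_flip_point (f : bool -> bool -> bool) : depends_on_both f ->
  exists s t, f (~~ s) t = ~~ f s t /\ f s (~~ t) = ~~ f s t.
Proof.
case=> -[s1 [u1 [v1 h1]]] [s2 [u2 [v2 h2]]].
suff: [exists s, exists t, (f (~~ s) t == ~~ f s t) && (f s (~~ t) == ~~ f s t)].
  by move=> /existsP[s /existsP[t /andP[/eqP ? /eqP ?]]]; exists s, t.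
apply: contraT; rewrite negb_exists => /forallP flip.
have {}flip s t : ~~ ((f (~~ s) t == ~~ f s t) && (f s (~~ t) == ~~ f s t)).
  by have := flip s; rewrite negb_exists => /forallP.
move: h1 h2 (flip true true) (flip true false) (flip false true) (flip false false).
by case: s1 u1 v1 s2 u2 v2 => [] [] [] [] [] [];
  case: (f true true) (f true false) (f false true) (f false false)
    => [] [] [] [] //=.
Qed.

(** * The two languages and their union *)

Definition parity_lang (c : bool) : pred (seq (option bool)) :=
  fun w => (ohead w == Some (Some c)) && (odd (count_mem None w) != c).

Lemma parity_lang_union_not_recognizable (R : realType) :
  ~ qfa_recognizable R (fun w => parity_lang true w || parity_lang false w).
Proof.
(* The prefixes contain no [None], so the tail alone sets the parity: the empty tail suits
   [Some true], the tail [[:: None]] suits [Some false]. *)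
apply: (@merging_prefixes_not_recognizable R _ _ (Some true) (Some false) [::] [:: None]).
move=> r t tsub.
have t0 : count_mem None t = 0%N.
  by apply/count_memPn/negP => /tsub; rewrite !inE.
have r0 b : count_mem None (nseq r (Some b)) = 0%N by rewrite count_nseq mul0n.
by split; rewrite /parity_lang /= !count_cat t0 r0.
Qed.

(** * A QFA for each of the two languages *)

Section ParityAutomaton.
Variables (R : realType) (c : bool).
Local Notation toC := (real_complex R).

Definition table_mx (T : seq (seq R)) : 'M[R[i]]_6 :=
  map_mx toC (\matrix_(i, j) nth 0 (nth [::] T i) j).

Definition amplitudes (s : seq R) : 'cV[R[i]]_6 := map_mx toC (\col_i nth 0 s i).

Lemma table_mx_unitary (T : seq (seq R)) :
    (forall i j : 'I_6,
      \sum_(k < 6) nth 0 (nth [::] T i) k * nth 0 (nth [::] T j) k = (i == j)%:R) ->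
  table_mx T \is unitarymx.
Proof.
move=> orthT; apply/unitarymxP/matrixP => i j; rewrite !mxE.
rewrite -[RHS](rmorph_nat toC) -orthT rmorph_sum; apply: eq_bigr => k _.
by rewrite !mxE [Num.conj _]conjc_real -rmorphM.
Qed.

Lemma table_mx_amplitudes (T : seq (seq R)) (s s' : seq R) :
    (forall i : 'I_6, \sum_(k < 6) nth 0 (nth [::] T i) k * nth 0 s k = nth 0 s' i) ->
  table_mx T *m amplitudes s = amplitudes s'.
Proof.
move=> Ts; rewrite -map_mxM; congr map_mx; apply/colP => i; rewrite !mxE -Ts.
by apply: eq_bigr => k _; rewrite !mxE.
Qed.

(* States 0 and 1 hold the parity, 2 waits for the first letter, 3 accepts,
   and 4 and 5 reject. *)
Definition parity_acc : {set 'I_6} := [set q : 'I_6 | q == 3 :> nat].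
Definition parity_rej : {set 'I_6} := [set q : 'I_6 | (3 < q)%N].

(** Column [j] is the image of state [j]; columns 3 to 5 complete an orthogonal matrix. [RightEnd]
    accepts from state 0 and rejects from state 1, and [None] exchanges the two. Any symbol after
    [LeftEnd] halts the waiting amplitude. The triple 3, 4, 5 keeps the entries rational. *)
Definition parity_table (a : endmarked (option bool)) : seq (seq R) :=
  match a with
  | LeftEnd =>
      if c then
        [:: [:: - 4/5; 0; 3/5; 0; 0; 0];
            [:: 0; 1; 0; 0; 0; 0];
            [:: 3/5; 0; 4/5; 0; 0; 0];
            [:: 0; 0; 0; 1; 0; 0];
            [:: 0; 0; 0; 0; 1; 0];
            [:: 0; 0; 0; 0; 0; 1]]
      else
        [:: [:: 1; 0; 0; 0; 0; 0];
            [:: 0; - 4/5; 3/5; 0; 0; 0];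
            [:: 0; 3/5; 4/5; 0; 0; 0];
            [:: 0; 0; 0; 1; 0; 0];
            [:: 0; 0; 0; 0; 1; 0];
            [:: 0; 0; 0; 0; 0; 1]]
  | RightEnd =>
      [:: [:: 0; 0; 0; 1; 0; 0];
          [:: 0; 0; 0; 0; 1; 0];
          [:: 0; 0; 0; 0; 0; 1];
          [:: 1; 0; 0; 0; 0; 0];
          [:: 0; 1; 0; 0; 0; 0];
          [:: 0; 0; 1; 0; 0; 0]]
  | Letter None =>
      [:: [:: 0; 1; 0; 0; 0; 0];
          [:: 1; 0; 0; 0; 0; 0];
          [:: 0; 0; 0; 0; 1; 0];
          [:: 0; 0; 0; 1; 0; 0];
          [:: 0; 0; 1; 0; 0; 0];
          [:: 0; 0; 0; 0; 0; 1]]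
  | Letter (Some b) =>
      if b == c then
        [:: [:: 1; 0; 0; 0; 0; 0];
            [:: 0; 1; 0; 0; 0; 0];
            [:: 0; 0; 0; 1; 0; 0];
            [:: 0; 0; 4/5; 0; 3/5; 0];
            [:: 0; 0; 3/5; 0; - 4/5; 0];
            [:: 0; 0; 0; 0; 0; 1]]
      else
        [:: [:: 1; 0; 0; 0; 0; 0];
            [:: 0; 1; 0; 0; 0; 0];
            [:: 0; 0; 0; 0; 1; 0];
            [:: 0; 0; 0; 1; 0; 0];
            [:: 0; 0; 1; 0; 0; 0];
            [:: 0; 0; 0; 0; 0; 1]]
  end.

Lemma sum_ord6 (F : 'I_6 -> R) (G : nat -> R) : (forall i : 'I_6, F i = G i) ->
  \sum_i F i = G 0 + (G 1 + (G 2 + (G 3 + (G 4 + G 5)))).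
Proof.
move=> FG; rewrite (eq_bigr (fun i : 'I_6 => G i)) //.
by rewrite !big_ord_recl big_ord0 /= addr0.
Qed.

Lemma parity_unitary a : table_mx (parity_table a) \is unitarymx.
Proof.
apply: table_mx_unitary => -[i i6] -[j j6]; rewrite -val_eqE /=.
rewrite (sum_ord6 (G := fun k => nth 0 (nth [::] (parity_table a) i) k
  * nth 0 (nth [::] (parity_table a) j) k)) // /parity_table.
case: a => [||[b|]]; [case: c | | case: (b == c) | ];
  by case: i i6 => [|[|[|[|[|[|i]]]]]] // _; case: j j6 => [|[|[|[|[|[|j]]]]]] // _ /=;
  lra.
Qed.

Lemma parity_disjoint : [disjoint parity_acc & parity_rej].
Proof.
by apply/pred0Pn => -[q]; rewrite /= !inE => /andP[/eqP ->].
Qed.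

Definition parity_qfa : qfa R (option bool) :=
  QFA (Ordinal (isT : (2 < 6)%N)) parity_unitary parity_disjoint.

Lemma parity_step (a : endmarked (option bool)) (s s' : seq R) :
    (forall i, (i < 6)%N ->
      let t k := nth 0 (nth [::] (parity_table a) i) k * nth 0 s k in
      t 0 + (t 1 + (t 2 + (t 3 + (t 4 + t 5)))) = nth 0 s' i) ->
  qfa_V parity_qfa a *m amplitudes s = amplitudes s'.
Proof.
move=> step; apply: table_mx_amplitudes => -[i i6]; rewrite -(step i i6).
exact: (sum_ord6 (G := fun k => nth 0 (nth [::] (parity_table a) i) k * nth 0 s k)).
Qed.

Lemma sqnorm_parity (A : {set 'I_6}) (m : pred nat) s :
    (forall q : 'I_6, (q \in A) = m q) ->
  sqnorm (proj_states A (amplitudes s)) =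
  let t k := if m k then nth 0 s k ^+ 2 else 0 in
  t 0 + (t 1 + (t 2 + (t 3 + (t 4 + t 5)))).
Proof.
move=> mA; pose t k := if m k then nth 0 s k ^+ 2 else 0.
rewrite /sqnorm (sum_ord6 (G := t)) // /t => q; rewrite sqr_normc_ReIm !mxE mA.
by case: (m q) => /=; rewrite expr0n addr0 // expr0n.
Qed.

Lemma sqnorm_parity_acc s :
  sqnorm (proj_states parity_acc (amplitudes s)) = nth 0 s 3 ^+ 2.
Proof.
rewrite (sqnorm_parity (m := fun q => q == 3)) => [|q]; last by rewrite inE.
by rewrite /= !add0r !addr0.
Qed.

Lemma sqnorm_parity_rej s :
  sqnorm (proj_states parity_rej (amplitudes s)) = nth 0 s 4 ^+ 2 + nth 0 s 5 ^+ 2.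
Proof.
rewrite (sqnorm_parity (m := fun q => 3 < q)%N) => [|q]; last by rewrite inE.
by rewrite /= !add0r.
Qed.

Lemma proj_parity_non s :
  proj_states (qfa_non parity_qfa) (amplitudes s)
  = amplitudes [:: nth 0 s 0; nth 0 s 1; nth 0 s 2].
Proof.
by apply/colP => -[[|[|[|[|[|[|q]]]]]] // q6]; rewrite !mxE !inE.
Qed.

Lemma parity_halt (a : endmarked (option bool)) (s s' : seq R) w :
    (forall i, (i < 6)%N ->
      let t k := nth 0 (nth [::] (parity_table a) i) k * nth 0 s k in
      t 0 + (t 1 + (t 2 + (t 3 + (t 4 + t 5)))) = nth 0 s' i) ->
  let next := amplitudes [:: nth 0 s' 0; nth 0 s' 1; nth 0 s' 2] in
  halt_prob (M := parity_qfa) parity_acc (amplitudes s) (a :: w)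
    = nth 0 s' 3 ^+ 2 + halt_prob (M := parity_qfa) parity_acc next w /\
  halt_prob (M := parity_qfa) parity_rej (amplitudes s) (a :: w)
    = nth 0 s' 4 ^+ 2 + nth 0 s' 5 ^+ 2
      + halt_prob (M := parity_qfa) parity_rej next w.
Proof.
move=> /parity_step step /=; rewrite step.
by rewrite sqnorm_parity_acc sqnorm_parity_rej proj_parity_non.
Qed.

(** [b] tells whether the tracked parity sits in the state that [RightEnd] rejects; [z] is the
    waiting amplitude. *)
Definition parity_amp (b : bool) (z : R) : seq R :=
  [:: (~~ b)%:R * (3/5); b%:R * (3/5); z].

(** With no waiting amplitude left, the tracked 3/5 never splits: its whole weight 9/25 goes to one
    verdict. *)
Lemma parity_run (b : bool) (w : seq (option bool)) :
  let e := rcons (map Letter w) RightEnd in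
  let q := (b (+) odd (count_mem None w))%:R * (9 / 25) in
  halt_prob (M := parity_qfa) parity_acc (amplitudes (parity_amp b 0)) e = 9 / 25 - q
  /\ halt_prob (M := parity_qfa) parity_rej (amplitudes (parity_amp b 0)) e = q.
Proof.
elim: w b => [|a w IH] b e q; rewrite {}/e [map _ _]/= [rcons _ _]/= {}/q.
  have [|-> ->] := @parity_halt RightEnd (parity_amp b 0)
    [:: 0; 0; 0; (~~ b)%:R * (3/5); b%:R * (3/5); 0] [::].
    by case: b => -[|[|[|[|[|[|?]]]]]] //= _; lra.
  by case: b => /=; split; field.
have [|-> ->] := @parity_halt (Letter a) (parity_amp b 0)
    (parity_amp (b (+) (a == None)) 0) (rcons (map Letter w) RightEnd).
  rewrite /parity_table; case: a => [d|]; [case: (d == c) | ];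
    by case: b => -[|[|[|[|[|[|?]]]]]] //= _; lra.
have [] := IH (b (+) (a == None)); rewrite /= oddD oddb addbA.
by case: (b (+) _) => /= -> ->; split; ring.
Qed.

Lemma parity_start : basis_state R (qfa_q0 parity_qfa) = amplitudes [:: 0; 0; 1].
Proof. by apply/colP => -[[|[|[|[|[|[|q]]]]]] // q6]; rewrite !mxE. Qed.

Lemma parity_first w :
  halt_prob (M := parity_qfa) parity_acc (amplitudes [:: 0; 0; 1]) (LeftEnd :: w)
    = halt_prob (M := parity_qfa) parity_acc (amplitudes (parity_amp (~~ c) (4/5))) w
  /\ halt_prob (M := parity_qfa) parity_rej (amplitudes [:: 0; 0; 1]) (LeftEnd :: w)
    = halt_prob (M := parity_qfa) parity_rej (amplitudes (parity_amp (~~ c) (4/5))) w.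
Proof.
have [|-> ->] := @parity_halt LeftEnd [:: 0; 0; 1] (parity_amp (~~ c) (4/5)) w.
  by rewrite /parity_table; case: c => -[|[|[|[|[|[|?]]]]]] //= _; lra.
by case: c => /=; rewrite ?expr0n ?addr0 ?add0r.
Qed.

(* Reading [Some c] first accepts with probability 256/625, rejects with
   probability 144/625 and leaves 225/625 to the parity; 369 = 144 + 225. *)
Lemma parity_lang_recognizable : qfa_recognizable R (parity_lang c).
Proof.
exists parity_qfa, (369 / 625); split; first by lra.
move=> w; rewrite /accept_prob /reject_prob /endmark parity_start.
have [-> ->] := parity_first (rcons (map Letter w) RightEnd).
(* Sending the whole waiting amplitude to rejecting states already gives [16/25 = 400/625], above
   the required 369/625. *)
have early_reject a s' v :
    (forall i, (i < 6)%N ->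
      let t k := nth 0 (nth [::] (parity_table a) i) k
                 * nth 0 (parity_amp (~~ c) (4/5)) k in
      t 0 + (t 1 + (t 2 + (t 3 + (t 4 + t 5)))) = nth 0 s' i) ->
    (4/5) ^+ 2 <= nth 0 s' 4 ^+ 2 + nth 0 s' 5 ^+ 2 ->
    369 / 625 <= halt_prob (M := parity_qfa) parity_rej
                   (amplitudes (parity_amp (~~ c) (4/5))) (a :: v).
  move=> step; have [_ ->] := @parity_halt a _ s' v step; set next := amplitudes _.
  by have := halt_prob_ge0 (M := parity_qfa) parity_rej next v; lra.
case: w => [|[b|] w]; rewrite [map _ _]/= [rcons _ _]/= /parity_lang.
- split=> [//|_]; apply: (early_reject _
    [:: 0; 0; 0; c%:R * (3/5); (~~ c)%:R * (3/5); 4/5]).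
    by case: c => -[|[|[|[|[|[|?]]]]]] //= _; lra.
  by rewrite /= lerDr sqr_ge0.
- rewrite [ohead _]/= [count_mem _ _]/= add0n; case: (eqVneq b c) => [->|bc].
    (* The waiting 4/5 splits into [4/5 * 4/5] on state 3 and [4/5 * 3/5] on state 4. *)
    have [|-> ->] := @parity_halt (Letter (Some c)) (parity_amp (~~ c) (4/5))
      (parity_amp (~~ c) 0 ++ [:: 16/25; 12/25]) (rcons (map Letter w) RightEnd).
      by rewrite /parity_table eqxx; case: c => -[|[|[|[|[|[|?]]]]]] //= _; lra.
    have [] := parity_run (~~ c) w; rewrite eqxx andTb [nth _ _ 0]/= [nth _ _ 1]/=
      [nth _ _ 2]/= [nth _ _ 3]/= [nth _ _ 4]/= [nth _ _ 5]/=.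
    move=> -> ->.
    by case: (odd (count_mem None w)) (c) => -[] /=; split=> // _; lra.
  have cb : (Some (Some b) == Some (Some c)) = false by apply: contraNF bc => /eqP[->].
  rewrite cb; split=> [//|_]; apply: (early_reject _ (parity_amp (~~ c) 0 ++ [:: 0; 4/5])).
    rewrite /parity_table (negPf bc).
    by case: c => -[|[|[|[|[|[|?]]]]]] //= _; lra.
  by case: c => /=; rewrite lerDl sqr_ge0.
(* A leading [None] flips the tracked parity, hence [c] in place of [~~ c]. *)
- split=> [//|_]; apply: (early_reject _ (parity_amp c 0 ++ [:: 0; 4/5])).
    by case: c => -[|[|[|[|[|[|?]]]]]] //= _; lra.
  by case: c => /=; rewrite lerDl sqr_ge0.
Qed.

End ParityAutomaton.

Theorem corollary3p2 (R : realType) (f : bool -> bool -> bool)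
    (hf : depends_on_both f) :
  exists (Sigma : finType) (L L' : pred (seq Sigma)),
    [/\ qfa_recognizable R L,
        qfa_recognizable R L' &
        ~ qfa_recognizable R (lang_op f L L')].
Proof.
have [s [t [flip_s flip_t]]] := exists_flip_point hf.
(* Words in neither piece land on the corner [(s, t)], words in exactly one piece on a neighbouring
   corner, where [f] takes the other value. *)
exists (option bool : finType), (fun w => s (+) parity_lang true w),
  (fun w => t (+) parity_lang false w).
split; try exact/addb_recognizable/parity_lang_recognizable.
move=> /(@addb_recognizable _ _ (f s t)) rec.
apply: (@parity_lang_union_not_recognizable R); apply: eq_recognizable rec => w.
rewrite /lang_op; case Lw: (parity_lang true w); case L'w: (parity_lang false w).
(* The opposite corner never occurs, since the two pieces prescribe different first letters. *)
- by move: Lw L'w; rewrite /parity_lang => /andP[/eqP ->].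
- by rewrite addbT addbF flip_s addbN addbb.
- by rewrite addbT addbF flip_t addbN addbb.
- by rewrite !addbF addbb.
Qed.
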